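(* Fix an integer $m\ge1$ and let $\boldsymbol\alpha=(\alpha_i)_{i\ge m}$ be indeterminates. For each integer $j\ge0$, let $\mathsf S^{(m;j)}=(S^{(m;j)}_{n,k})_{n,k\ge0}$, where $S^{(m;j)}_{n,k}$ is the sum over partial $m$-Dyck paths from $(0,0)$ to $((m+1)n+j,(m+1)k+j)$ of the product of step weights, each rise having weight $1$ and each $m$-fall from height $i$ weight $\alpha_i$. Then for every $j\ge0$ the lower-triangular matrix $\mathsf S^{(m;j)}$ is totally positive in $\mathbb Z[\boldsymbol\alpha]$ equipped with the coefficientwise order.
   Context: A partial $m$-Dyck path is a path in $\mathbb Z\times\mathbb N$ starting on the horizontal axis, using steps $(1,1)$ (rises) and $(1,-m)$ ($m$-falls). Coefficientwise total positivity: all minors are polynomials with nonnegative coefficients. *)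

(* Defs.v *)
From mathcomp Require Import all_boot all_order all_algebra.
From mathcomp Require Export finmap monalg.

Set Implicit Arguments.
Unset Strict Implicit.
Unset Printing Implicit Defensive.

Import Order.TTheory GRing.Theory Num.Theory.
Local Open Scope ring_scope.

(* Z[alpha] with alpha = (alpha_i)_{i >= m}: the monoid algebra over Z of the
   commutative monomials in countably many letters, indexed by {i | m <= i}. *)
Definition Zalpha (m : nat) : comNzRingType :=
  {malg int[{cmonom {i : nat | (m <= i)%N}}]}.

(* The value 0 for i < m is a dummy one: a fall from such a height would go
   below the horizontal axis. *)
Definition alpha (m i : nat) : Zalpha m :=
  if insub i is Some u then << ucm u >> else 0.

Definition coef_nonneg (m : nat) (p : Zalpha m) : Prop :=
  forall mon : {cmonom {i : nat | (m <= i)%N}}, 0 <= p@_mon.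

(* For infinite matrices indexed by nat x nat; row and column sets of a minor
   are given by their strictly increasing enumerations. *)
Definition totally_positive (m : nat) (A : nat -> nat -> Zalpha m) : Prop :=
  forall (r : nat) (f g : 'I_r -> nat),
    (forall a b : 'I_r, (a < b)%N -> (f a < f b)%N) ->
    (forall a b : 'I_r, (a < b)%N -> (g a < g b)%N) ->
    coef_nonneg (\det (\matrix_(a < r, b < r) A (f a) (g b))).

(* A path starting at the origin is encoded by its word of steps,
   true = rise (1,1) and false = m-fall (1,-m). *)
Definition step (m : nat) (b : bool) : int * int :=
  (1, if b then 1 else - m%:Z).

Definition vertex (m : nat) (s : seq bool) (t : nat) : int * int :=
  \sum_(b <- take t s) step m b.

Definition height (m : nat) (s : seq bool) (t : nat) : int := (vertex m s t).2.

Definition is_partial_Dyck (m : nat) (s : seq bool) : bool :=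
  [forall t : 'I_(size s).+1, 0 <= height m s t].

(* The partial m-Dyck paths from (0,0) to (x,y); as each step advances the
   abscissa by 1, such a path has exactly x steps. *)
Definition partial_Dyck (m x y : nat) : {set x.-tuple bool} :=
  [set s : x.-tuple bool | is_partial_Dyck m s &
                           vertex m s x == (x%:Z, y%:Z)].

(* The absolute value only converts the (nonnegative) height to nat. *)
Definition weight (m : nat) (s : seq bool) : Zalpha m :=
  \prod_(t < size s)
    (if nth true s t then 1 else alpha m `|height m s t|%N).

Definition Smat (m j n k : nat) : Zalpha m :=
  \sum_(s in partial_Dyck m (m.+1 * n + j) (m.+1 * k + j)) weight m s.

(* Main.v *)
Require Import Defs.
From mathcomp Require Import all_boot all_order all_algebra.
From mathcomp Require Import zify.

(** Let [W x y] be the weighted number of partial m-Dyck paths of length [x]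
    ending at height [y], and [A_c n k := W ((m+1)n + c) ((m+1)k + c)].  After
    [x] steps the height is congruent to [x] modulo [m+1], so one more step acts
    on these height classes by a bidiagonal matrix: [A_(c+1)] is [A_c] times a
    lower bidiagonal one for every [c], while row [n+1] of [A_0] is row [n] of
    [A_m] times an upper bidiagonal one, and row [0] of [A_0] is (1, 0, 0, ...).
    Each of these operations preserves nonnegativity of minors, so an induction
    on the number of leading rows allowed in the minors gives the result. *)

Set Implicit Arguments.
Unset Strict Implicit.
Unset Printing Implicit Defensive.

Import Order.TTheory GRing.Theory Num.Theory.
Local Open Scope ring_scope.

Definition strictly_increasing (r : nat) (f : 'I_r -> nat) :=
  forall a b : 'I_r, (a < b)%N -> (f a < f b)%N.

(** * Minors over a ring with a class [P] of nonnegative elements *)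

Section MinorPositivity.

Variables (R : comNzRingType) (P : R -> Prop).
Hypotheses (P0 : P 0) (P1 : P 1).
Hypothesis PD : forall p q, P p -> P q -> P (p + q).
Hypothesis PM : forall p q, P p -> P q -> P (p * q).

(** Only the rows are bounded by [N]: the induction runs on rows, while the bidiagonal steps shift
    columns. *)
Definition row_minors (N : nat) (A : nat -> nat -> R) :=
  forall (r : nat) (f g : 'I_r -> nat),
    strictly_increasing f -> strictly_increasing g ->
    (forall a, f a < N)%N ->
    P (\det (\matrix_(a < r, b < r) A (f a) (g b))).

Lemma eq_row_minors N A B :
  (forall n k, A n k = B n k) -> row_minors N A -> row_minors N B.
Proof.
move=> eqAB hA r f g hf hg hN.
by under eq_mx do rewrite -eqAB; apply: hA.
Qed.

Lemma det_repeated_col r (A : nat -> nat -> R) (f c : 'I_r -> nat) (a b : 'I_r) :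
  a != b -> c a = c b -> \det (\matrix_(i < r, k < r) A (f i) (c k)) = 0.
Proof.
move=> neq_ab eqc; rewrite -det_tr.
by apply: (determinant_alternate neq_ab) => k; rewrite !mxE eqc.
Qed.

(** Multilinearity in the columns: after transposing, the Leibniz product runs over columns and
    distributes over the choices [e]. *)
Lemma det_col_expansion r (B : bool -> 'I_r -> 'I_r -> R) :
  \det (\matrix_(i, k) \sum_(e : bool) B e i k) =
  \sum_(e : {ffun 'I_r -> bool}) \det (\matrix_(i, k) B (e k) i k).
Proof.
rewrite -det_tr /determinant.
under eq_bigr => s _.
  under eq_bigr => k _ do rewrite !mxE.
  rewrite bigA_distr_bigA mulr_sumr.
  over.
rewrite exchange_big; apply: eq_bigr => e _.
rewrite -[RHS]det_tr; apply: eq_bigr => s _; congr (_ * _).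
by apply: eq_bigr => k _; rewrite !mxE.
Qed.

(* Right multiplication by a bidiagonal matrix: column [k] becomes a combination
   of the columns [h true k] and [h false k].  Expanding the determinant in its
   columns, the interlacing hypothesis makes the chosen columns weakly
   increasing, and a tie kills the determinant. *)
Lemma row_minors_bidiagonal N A (h : bool -> nat -> nat) (w : bool -> nat -> R) :
  (forall e e' k l, (k < l)%N -> (h e k <= h e' l)%N) ->
  (forall e k, P (w e k)) ->
  row_minors N A ->
  row_minors N (fun n k => \sum_(e : bool) A n (h e k) * w e k).
Proof.
move=> hmono Pw hA r f g hf hg hN.
rewrite det_col_expansion; apply: big_ind => // e _.
pose c k := h (e k) (g k).
have -> : \matrix_(i, k) (A (f i) (h (e k) (g k)) * w (e k) (g k)) =
    \matrix_(i, k) A (f i) (c k) *m diag_mx (\row_k w (e k) (g k)).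
  by apply/matrixP => i k; rewrite mul_mx_diag !mxE.
rewrite det_mulmx det_diag; apply: PM; last first.
  by apply: big_ind => // k _; rewrite mxE.
case: (boolP (injectiveb c)) => [/injectiveP inj_c|/injectivePn[a [b neq_ab eqc]]].
  apply: hA => // a b lt_ab; rewrite ltn_neqAle.
  apply/andP; split; last by apply: hmono; apply: hg.
  by apply: contraTneq lt_ab => /inj_c ->; rewrite ltnn.
by rewrite (det_repeated_col _ _ neq_ab eqc).
Qed.

(** If row 0 is selected, only the first selected column can meet its nonzero entry, so the minor is
    0 or a smaller minor of the shifted matrix. Otherwise all selected rows are positive and the
    minor is one of the shifted matrix. *)
Lemma row_minors_cons N A :
  row_minors N (fun n k => A n.+1 k) ->
  (forall k, A 0%N k = (k == 0%N)%:R) ->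
  row_minors N.+1 A.
Proof.
move=> hA A0 [|r] f g hf hg hN; first by rewrite det_mx00.
have posS (i j : 'I_r.+1) : (i < j)%N -> (0 < f j)%N by move/hf; case: (f j).
case: (posnP (f ord0)) => [f0|f0].
  rewrite (expand_det_row _ ord0) big_ord_recl mxE f0 A0 big1 => [|k _]; last first.
    rewrite mxE f0 A0; have /hg : ((ord0 : 'I_r.+1) < lift ord0 k)%N by [].
    by case: (g (lift _ _)) => // n _; rewrite mul0r.
  rewrite addr0; apply: PM; first by case: eqP.
  rewrite /cofactor mul1r.
  have -> : row' ord0 (col' ord0 (\matrix_(a, b) A (f a) (g b))) =
      \matrix_(a, b) A (f (lift ord0 a)).-1.+1 (g (lift ord0 b)).
    by apply/matrixP => a b; rewrite !mxE prednK // (posS ord0).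
  apply: (hA _ (fun a => (f (lift ord0 a)).-1)) => [a b lt_ab|a b lt_ab|a].
  - have /hf : (lift ord0 a < lift ord0 b)%N by [].
    have := posS ord0 (lift ord0 a) isT; lia.
  - exact: hg.
  - have := posS ord0 (lift ord0 a) isT; have := hN (lift ord0 a); lia.
have fpos a : (0 < f a)%N.
  by case: (unliftP ord0 a) => [b ->|->] //; apply: (posS ord0).
under eq_mx do rewrite -(prednK (fpos _)).
apply: (hA _ (fun a => (f a).-1)) => // [a b /hf|a].
  by have := fpos a; lia.
by have := fpos a; have := hN a; lia.
Qed.

(** * Path sums and their recursion by the last step *)

Variables (m : nat) (wt : nat -> R).
Hypothesis Pwt : forall i, P (wt i).

(* Weighted count of the partial m-Dyck paths with [x] steps ending at height
   [y], by their last step. *)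
Fixpoint path_sum (x y : nat) : R :=
  if x is x'.+1 then
    (if y is y'.+1 then path_sum x' y' else 0) +
    path_sum x' (y + m) * wt (y + m)
  else (y == 0%N)%:R.

Lemma path_sum_high x y : (x < y)%N -> path_sum x y = 0.
Proof.
elim: x y => [|x IHx] [|y] //= lt_xy.
by rewrite !IHx ?mul0r ?addr0 //; lia.
Qed.

Definition path_matrix (c n k : nat) := path_sum (m.+1 * n + c) (m.+1 * k + c).

Lemma path_matrixS c n k :
  path_matrix c.+1 n k =
  path_matrix c n k + path_matrix c n k.+1 * wt (m.+1 * k.+1 + c).
Proof.
rewrite /path_matrix !addnS /=; congr (_ + path_sum _ _ * wt _); lia.
Qed.

(** A rise to height (m+1)k starts at (m+1)(k-1)+m; the factor [(0 < k)%:R] cancels the default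
    value of [k.-1] at [k = 0]. *)
Lemma path_matrix0S n k :
  path_matrix 0 n.+1 k =
  path_matrix m n k.-1 * (0 < k)%:R + path_matrix m n k * wt (m.+1 * k + m).
Proof.
rewrite /path_matrix.
have -> : (m.+1 * n.+1 + 0 = (m.+1 * n + m).+1)%N by lia.
case: k => [|k]; first by rewrite mulr0 muln0.
have -> : (m.+1 * k.+1 + 0 = (m.+1 * k + m).+1)%N by lia.
rewrite mulr1 /=; congr (_ + path_sum _ _ * wt _); lia.
Qed.

Lemma row_minors_path_matrixS N c :
  row_minors N (path_matrix 0) -> row_minors N (path_matrix c).
Proof.
move=> h0; elim: c => // c IHc.
(* [true] marks a fall, which starts one column to the right, and [false] a rise. *)
pose w (e : bool) k := if e then wt (m.+1 * k.+1 + c) else 1.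
apply: (@eq_row_minors _
  (fun n k => \sum_(e : bool) path_matrix c n (k + e) * w e k)) => [n k|].
  by rewrite big_bool path_matrixS /= addn0 addn1 mulr1 addrC.
by apply: row_minors_bidiagonal => [[] [] k l|[] k|] //=; lia.
Qed.

Lemma row_minors_path_matrix0 N : row_minors N (path_matrix 0).
Proof.
elim: N => [|N IHN].
  by move=> [|r] f g _ _ hN; [rewrite det_mx00 | have := hN ord0].
apply: row_minors_cons => [|k]; last by rewrite /path_matrix muln0 /= addn0 muln_eq0.
(* Here [true] marks a rise, which starts one column to the left. *)
pose w (e : bool) k := if e then (0 < k)%:R else wt (m.+1 * k + m).
apply: (@eq_row_minors _
  (fun n k => \sum_(e : bool) path_matrix m n (k - e) * w e k)) => [n k|].
  by rewrite big_bool path_matrix0S /= subn0 subn1.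
apply: row_minors_bidiagonal => [[] [] k l|[] [|k]|] //=; try lia.
exact: row_minors_path_matrixS.
Qed.

Lemma path_matrix_minors c r (f g : 'I_r -> nat) :
  strictly_increasing f -> strictly_increasing g ->
  P (\det (\matrix_(a < r, b < r) path_matrix c (f a) (g b))).
Proof.
move=> hf hg.
(* A minor uses finitely many rows, so the largest row index gives a bound. *)
apply: (@row_minors_path_matrixS (\max_a f a).+1) => // [|a].
  exact: row_minors_path_matrix0.
by rewrite ltnS leq_bigmax.
Qed.

End MinorPositivity.

(** * Closure properties of coefficientwise nonnegativity *)

Section Coefficients.

Variable m : nat.

Lemma coef_nonneg0 : coef_nonneg (0 : Zalpha m).
Proof. by move=> mon; rewrite mcoeff0. Qed.

Lemma coef_nonneg1 : coef_nonneg (1 : Zalpha m).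
Proof. by move=> mon; rewrite mcoeff1; case: eqP. Qed.

Lemma coef_nonnegD (p q : Zalpha m) :
  coef_nonneg p -> coef_nonneg q -> coef_nonneg (p + q).
Proof. by move=> hp hq mon; rewrite mcoeffD addr_ge0. Qed.

Lemma coef_nonnegM (p q : Zalpha m) :
  coef_nonneg p -> coef_nonneg q -> coef_nonneg (p * q).
Proof.
move=> hp hq mon; rewrite mcoeffMl.
by apply: sumr_ge0 => i _; apply: sumr_ge0 => k _; rewrite mulrn_wge0 ?mulr_ge0.
Qed.

Lemma coef_nonneg_alpha i : coef_nonneg (alpha m i).
Proof.
rewrite /alpha; case: insubP => [u _ _|_]; last exact: coef_nonneg0.
by move=> mon; rewrite mcoeffU; case: eqP.
Qed.

End Coefficients.

(** * Decomposition of paths by their last step *)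

Section Paths.

Variable m : nat.

Lemma vertex_rcons s b t : (t <= size s)%N -> vertex m (rcons s b) t = vertex m s t.
Proof. by move=> le_ts; rewrite /vertex -cats1 takel_cat. Qed.

Lemma vertex_rcons_last s b :
  vertex m (rcons s b) (size s).+1 = vertex m s (size s) + step m b.
Proof.
by rewrite /vertex -(size_rcons s b) !take_size -cats1 big_cat big_seq1.
Qed.

Lemma is_partial_Dyck_rcons s b :
  is_partial_Dyck m (rcons s b) =
  is_partial_Dyck m s && (0 <= height m (rcons s b) (size s).+1).
Proof.
apply/forallP/andP => [H|[/forallP H Hlast] t].
  split.
    apply/forallP => t; have lt_t : (t < (size (rcons s b)).+1)%N.
      by rewrite size_rcons; apply: leq_trans (ltn_ord t) _.
    have := H (Ordinal lt_t).
    by rewrite /height vertex_rcons //; exact: (ltn_ord t).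
  have lt_s : ((size s).+1 < (size (rcons s b)).+1)%N by rewrite size_rcons.
  exact: (H (Ordinal lt_s)).
case: (ltngtP t (size s).+1) => [lt_t|gt_t|->] //.
  have := H (Ordinal lt_t).
  by rewrite /height vertex_rcons.
have le_t : (t <= size (rcons s b))%N := ltn_ord t.
by move: gt_t; rewrite -(size_rcons s b) ltnNge le_t.
Qed.

Lemma weight_rcons s b :
  weight m (rcons s b) =
  weight m s * (if b then 1 else alpha m `|height m s (size s)|%N).
Proof.
rewrite /weight size_rcons big_ord_recr /=; congr (_ * _).
  apply: eq_bigr => t _.
  by rewrite nth_rcons ltn_ord /height vertex_rcons // ltnW.
by rewrite nth_rcons ltnn eqxx /height vertex_rcons.
Qed.

(** Injectivity suffices, as both sides have 2^(x+1) elements. *)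
Lemma rcons_tuple_bij x :
  bijective (fun p : bool * x.-tuple bool => [tuple of rcons p.2 p.1]).
Proof.
apply: inj_card_bij; last by rewrite card_prod !card_tuple card_bool expnS.
by move=> [b s] [b' s'] /(congr1 val) /= /rcons_inj[/val_inj -> ->].
Qed.

Lemma partial_Dyck_rcons x y (s : x.-tuple bool) b :
  ([tuple of rcons s b] \in partial_Dyck m x.+1 y) =
  [&& is_partial_Dyck m s, (b ==> (0 < y)%N) &
      vertex m s x == (x%:Z, (if b then y.-1 else y + m)%N%:Z)].
Proof.
rewrite inE /= is_partial_Dyck_rcons /height.
have := vertex_rcons_last s b; rewrite size_tuple => ->.
(* The end of [s] has nonnegative height, which rules out a rise ending at height 0. *)
case: (boolP (is_partial_Dyck m s)) => //= /forallP /(_ ord_max) /=.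
rewrite /height size_tuple.
case: (vertex m s x) => u v /= v_ge0.
rewrite /step -!pair_eqE /=; case: b => /=; lia.
Qed.

Lemma path_sumE x y :
  \sum_(s in partial_Dyck m x y) weight m s = path_sum m (alpha m) x y.
Proof.
elim: x y => [|x IHx] y.
  rewrite (eq_bigl (fun s => (s == [tuple]) && (y == 0%N))) => [|s].
    rewrite big_mkcondr big_pred1_eq /weight big_ord0.
    by rewrite /=; case: eqP.
  rewrite (tuple0 s) eqxx inE /vertex big_nil -pair_eqE /= andbC eq_sym.
  rewrite (_ : is_partial_Dyck m [::]) ?andbT //.
  by apply/forallP => t; rewrite /height /vertex big_nil.
rewrite (reindex _ (onW_bij _ (rcons_tuple_bij x))) /=.
transitivity (\sum_(b : bool) \sum_(s : x.-tuple bool |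
    [tuple of rcons s b] \in partial_Dyck m x.+1 y) weight m (rcons s b)).
  by rewrite pair_big_dep.
rewrite big_bool /=.
congr (_ + _).
  under eq_bigl => s do rewrite partial_Dyck_rcons.
  case: y => [|y]; first by rewrite big1 // => s /andP[].
  rewrite -IHx; apply: eq_big => [s|s _]; first by rewrite inE.
  by rewrite weight_rcons mulr1.
rewrite -IHx mulr_suml; apply: eq_big => [s|s].
  by rewrite partial_Dyck_rcons inE.
(* The endpoint of [s] fixes the starting height of the fall as [y + m]. *)
rewrite partial_Dyck_rcons weight_rcons /height size_tuple.
by case/and3P => _ _ /eqP->.
Qed.

End Paths.

Theorem theoremA5 (m : nat) (hm : (1 <= m)%N) (j : nat) :
  (forall n k : nat, (n < k)%N -> Smat m j n k = 0%R) /\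
  totally_positive (Smat m j).
Proof.
have SE n k : Smat m j n k = path_matrix m (alpha m) j n k by exact: path_sumE.
split=> [n k lt_nk|r f g hf hg].
  (* A path of x steps cannot end above height x. *)
  by rewrite SE; apply: path_sum_high; rewrite ltn_add2r ltn_pmul2l.
under eq_mx do rewrite SE.
apply: (@path_matrix_minors _ (@coef_nonneg m)) => //.
- exact: coef_nonneg0.
- exact: coef_nonneg1.
- exact: coef_nonnegD.
- exact: coef_nonnegM.
- exact: coef_nonneg_alpha.
Qed.
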